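(* Let $\mathcal{W}$, $\varepsilon:\mathcal{W}\to\{\pm1\}$ and $T:\mathcal{W}\to A^0$ be as in the context. Each element $w\in\mathcal{W}$ has a unique expression in the form $$w=w_\epsilon^{\delta_{\varepsilon(w),1}}\,w_{\epsilon+T(w)},$$ where $\delta$ is the Kronecker delta. In particular, if $\dot{\mathcal{W}}:=\langle w_\epsilon\rangle$ is the finite Weyl group of type $A_1$ and $\mathcal{W}^0:=\ker(\varepsilon)$, then $$\mathcal{W}=\dot{\mathcal{W}}\ltimes\mathcal{W}^0$$ (semidirect product with $\mathcal{W}^0$ normal).
   Context: Let $A$ be an abelian group with a symmetric positive semidefinite bi-additive form $(\cdot,\cdot):A\times A\to\mathbb{Q}$ and radical $A^0=\{\alpha\in A:(\alpha,A)=0\}$. Assume there is $\epsilon\in A$ with $(\epsilon,\epsilon)=2$ and $A=\mathbb{Z}\epsilon\oplus A^0$. Write each $\alpha\in A$ uniquely as $\alpha=\mathrm{sgn}(\alpha)\epsilon+p(\alpha)$ with $\mathrm{sgn}(\alpha)\in\mathbb{Z}$, $p(\alpha)\in A^0$. Let $\tilde R=A^0\cup(\pm\epsilon+A^0)$ (an affine reflection system of type $A_1$ in $A$) and $\tilde R^\times=\pm\epsilon+A^0=(\epsilon+A^0)\cup(-\epsilon+A^0)$. For $\alpha\in\tilde R^\times$ let $w_\alpha\in\mathrm{Aut}(A)$, $w_\alpha(\beta)=\beta-\frac{2(\beta,\alpha)}{(\alpha,\alpha)}\alpha$. The $A_1$-type Weyl group on $A$ is $\mathcal{W}=\langle w_\alpha:\alpha\in\tilde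 R^\times\rangle\subseteq\mathrm{Aut}(A)$. For $w\in\mathcal{W}$ choose any expression $w=w_{\alpha_1}\cdots w_{\alpha_n}$ with $\alpha_i\in\tilde R^\times$ and set $\varepsilon(w)=(-1)^n\in\{1,-1\}$ and $T(w)=\sum_{i=1}^n(-1)^{n-i}\mathrm{sgn}(\alpha_i)p(\alpha_i)\in A^0$. The paper asserts that both are independent of the chosen expression, and that $\varepsilon$ is a group homomorphism.
   Formalization: Uniqueness of T(w) in A^0 is stated under the premise that T is independent of the chosen expression, which fails if A^0 has an element r of order 2 (then w_ε = w_{ε+r}, giving T = 0 and T = r); all other claims are stated without this premise. *)

(* Defs.v *)
From HB Require Import structures.
From mathcomp Require Import all_boot all_order all_algebra.
From mathcomp Require Import boolp classical_sets.
From mathcomp Require Import ring.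

Set Implicit Arguments.
Unset Strict Implicit.
Unset Printing Implicit Defensive.

Import Order.TTheory GRing.Theory Num.Theory.
Local Open Scope classical_set_scope.
Local Open Scope ring_scope.

(* Aut(A), with composition as product: (f * g) x = f (g x). *)
Record aut (A : zmodType) := Aut {
  aut_val :> {additive A -> A};
  aut_bij : bijective aut_val }.

Section AutGroup.
Variable A : zmodType.
Implicit Types f g h : aut A.

Lemma aut_ext f g : f =1 g -> f = g.
Proof.
case: f g => [f fb] [g gb] /= fg.
have E : f = g.
  case: f g fg {fb gb} => [f [[fD]]] [g [[gD]]] /= /funext fg.
  by subst g; rewrite (Prop_irrelevance gD fD).
by subst g; rewrite (Prop_irrelevance gb fb).
Qed.

Fact aut_one_bij : bijective (idfun : {additive A -> A}).
Proof. by exists id. Qed.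

Definition aut_one : aut A := Aut aut_one_bij.

Fact aut_mul_bij f g : bijective (f \o g : {additive A -> A}).
Proof. exact: bij_comp (aut_bij f) (aut_bij g). Qed.

Definition aut_mul f g : aut A := Aut (aut_mul_bij f g).

Fact aut_inv_ex f : {g : aut A | cancel f g /\ cancel g f}.
Proof.
apply: cid; case: (aut_bij f) => g fK gK.
have gD : nmod_morphism g.
  split; first by apply: (can_inj fK); rewrite gK raddf0.
  by move=> x y; apply: (can_inj fK); rewrite raddfD !gK.
pose gm := GRing.isNmodMorphism.Build A A g gD.
pose ga : {additive A -> A} := HB.pack g gm.
have gb : bijective ga by exists f.
by exists (Aut gb).
Qed.

Definition aut_inv f : aut A := sval (aut_inv_ex f).

HB.instance Definition _ := gen_eqMixin (aut A).
HB.instance Definition _ := gen_choiceMixin (aut A).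

Fact aut_mulA : associative aut_mul.
Proof. by move=> f g h; apply: aut_ext. Qed.
Fact aut_mul1 : left_id aut_one aut_mul.
Proof. by move=> f; apply: aut_ext. Qed.
Fact aut_1mul : right_id aut_one aut_mul.
Proof. by move=> f; apply: aut_ext. Qed.
Fact aut_mulV : left_inverse aut_one aut_inv aut_mul.
Proof.
by move=> f; apply: aut_ext => x; have [fK _] := svalP (aut_inv_ex f); apply: fK.
Qed.
Fact aut_Vmul : right_inverse aut_one aut_inv aut_mul.
Proof.
by move=> f; apply: aut_ext => x; have [_ fK] := svalP (aut_inv_ex f); apply: fK.
Qed.

HB.instance Definition _ :=
  isGroup.Build (aut A) aut_mulA aut_mul1 aut_1mul aut_mulV aut_Vmul.

Lemma autM f g x : (f * g)%g x = f (g x). Proof. by []. Qed.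

Lemma aut1 x : (1%g : aut A) x = x. Proof. by []. Qed.

End AutGroup.

Section Subgroups.
Variable G : groupType.

Definition is_subgroup (H : set G) : Prop := group_closed [in H].

Definition generated (S : set G) : set G :=
  [set g | forall H : set G, is_subgroup H -> S `<=` H -> H g].

(* K is the internal semidirect product of its normal subgroup N by H. *)
Definition is_sdprod (K N H : set G) : Prop :=
  [/\ is_subgroup K, is_subgroup N & is_subgroup H] /\
  [/\ N `<=` K /\ (forall g n, K g -> N n -> N (n ^ g)%g),
      H `<=` K,
      H `&` N = [set 1%g] &
      K = [set (h * n)%g | h in H & n in N]].

End Subgroups.

Section A1.
Variables (A : zmodType) (form : A -> A -> rat) (eps : A).
Implicit Types (a b r x : A) (s : seq A) (w : aut A) (n : int).

Definition sym_form : Prop := forall a b, form a b = form b a.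

Definition biadditive : Prop :=
  (forall a b x, form (a + b) x = form a x + form b x) /\
  (forall x a b, form x (a + b) = form x a + form x b).

Definition pos_semidef : Prop := forall a, 0 <= form a a.

Definition radical : set A := [set a | forall b, form a b = 0].

Definition is_decomp a (nr : int * A) : Prop :=
  radical nr.2 /\ a = eps *~ nr.1 + nr.2.

Definition direct_decomp : Prop := forall a, exists! nr, is_decomp a nr.

Definition decomp a : int * A := xget (0, 0) (is_decomp a).
Definition sgn a : int := (decomp a).1.
Definition p a : A := (decomp a).2.

Definition real_roots : set A :=
  [set a | exists2 r, radical r & a = eps + r \/ a = - eps + r].

(* For a in real_roots the coefficient 2(b,a)/(a,a) is an integer (see coefE),
   hence equal to its numerator. *)
Definition refl_fun a b : A := b - a *~ numq (2 * form b a / form a a).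

(* The automorphism w_a. For a in real_roots it exists and is given by refl_fun
   (see reflE), so the default value 1 is never used there. *)
Definition refl a : aut A := xget 1%g [set f : aut A | f =1 refl_fun a].

Definition Weyl : set (aut A) := generated [set refl a | a in real_roots].

Definition root_seq s : Prop := forall a, a \in s -> real_roots a.

Definition prod_refl s : aut A := (\prod_(a <- s) refl a)%g.

Definition sign_seq s : int := (-1) ^+ size s.

(* With 0-based positions, the 1-based exponent n - i becomes n - i.+1. *)
Definition T_seq s : A :=
  \sum_(i < size s) p s`_i *~ ((-1) ^+ (size s - i.+1) * sgn s`_i).

Definition expression w : seq A :=
  xget [::] [set s | root_seq s /\ w = prod_refl s].

Definition signW w : int := sign_seq (expression w).

Definition T w : A := T_seq (expression w).

(* The value of T on w does not depend on the chosen expression of w. This holds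
   if and only if A^0 has no element of order 2: for r in A^0 with 2r = 0, the
   reflections in eps and eps + r coincide, but T_seq takes the values 0 and r. *)
Definition T_indep : Prop := forall s1 s2, root_seq s1 -> root_seq s2 ->
  prod_refl s1 = prod_refl s2 -> T_seq s1 = T_seq s2.

Definition Weyl0 : set (aut A) := [set w | Weyl w /\ signW w = 1].

Definition Weyl_dot : set (aut A) := generated [set refl eps].

Section Theory.
Hypotheses (form_sym : sym_form) (form_add : biadditive).
Hypotheses (eps2 : form eps eps = 2) (decA : direct_decomp).

Lemma decompP a : radical (p a) /\ a = eps *~ sgn a + p a.
Proof.
have [nr [nrP _]] := decA a.
by rewrite /p /sgn /decomp; case: xgetP => [x _ //|/(_ nr)].
Qed.

Lemma decomp_uniq n r : radical r ->
  sgn (eps *~ n + r) = n /\ p (eps *~ n + r) = r.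
Proof.
move=> r0; have [nr [_ nrU]] := decA (eps *~ n + r).
have E1 : nr = (n, r) by apply: nrU.
have E2 : nr = (sgn (eps *~ n + r), p (eps *~ n + r)) by apply/nrU/decompP.
by move: E2; rewrite E1 => -[<- <-].
Qed.

Lemma radical0 : radical 0.
Proof.
move=> b; have := form_add.1 0 0 b; rewrite addr0 => /eqP.
by rewrite -subr_eq0 opprD addNKr oppr_eq0 => /eqP.
Qed.

Lemma radicalD r1 r2 : radical r1 -> radical r2 -> radical (r1 + r2).
Proof. by move=> h1 h2 b; rewrite form_add.1 h1 h2 addr0. Qed.

Lemma radicalN r : radical r -> radical (- r).
Proof.
by move=> h b; have := form_add.1 r (- r) b; rewrite subrr radical0 h add0r => <-.
Qed.

Lemma radicalMz r n : radical r -> radical (r *~ n).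
Proof.
move=> h; have hn k : radical (r *+ k).
  by elim: k => [|k IH]; rewrite ?mulr0n ?mulrSr; [apply: radical0|apply: radicalD].
by case: n => k; rewrite ?NegzE ?mulrNz -?pmulrn //; apply: radicalN.
Qed.

Lemma form0l b : form 0 b = 0.
Proof. exact: radical0. Qed.

Lemma formMz a n b : form (a *~ n) b = form a b *~ n.
Proof.
have hN x : form (- x) b = - form x b.
  by apply/eqP; rewrite -addr_eq0 -form_add.1 addNr form0l.
have hn k : form (a *+ k) b = form a b *+ k.
  by elim: k => [|k IH]; rewrite ?mulr0n ?form0l // !mulrSr form_add.1 IH.
by case: n => k; rewrite ?NegzE ?mulrNz -?pmulrn ?hN hn.
Qed.

Lemma formE n1 r1 n2 r2 : radical r1 -> radical r2 ->
  form (eps *~ n1 + r1) (eps *~ n2 + r2) = (2 * n1 * n2)%:~R.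
Proof.
move=> h1 h2; rewrite form_add.1 h1 addr0 form_sym form_add.1 h2 addr0.
rewrite formMz form_sym formMz eps2 -[2%:R]/(2%:~R) -!mulrzA; congr (_%:~R); ring.
Qed.

Lemma rootP a : real_roots a <-> sgn a = 1 \/ sgn a = -1.
Proof.
split=> [[r r0 [] ->]|h].
- by have [E _] := decomp_uniq 1 r0; rewrite mulr1z in E; rewrite E; left.
- by have [E _] := decomp_uniq (-1) r0; rewrite mulrN1z in E; rewrite E; right.
have [p0 E] := decompP a; exists (p a) => //; move: E.
by case: h => -> E; [left|right]; rewrite {1}E ?mulr1z ?mulrN1z.
Qed.

Lemma coefE a b : real_roots a -> 2 * form b a / form a a = (2 * sgn b * sgn a)%:~R.
Proof.
move=> /rootP ha.
have E x y : form x y = (2 * sgn x * sgn y)%:~R.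
  have [px Ex] := decompP x; have [py Ey] := decompP y.
  by rewrite {1}Ex {1}Ey formE.
rewrite !E; case: ha => ->; rewrite ?rmorphM ?rmorphN /=; field=> //.
Qed.

Definition tau a := p a *~ sgn a.
Lemma tau0 a : radical (tau a).
Proof. by apply/radicalMz/(decompP a).1. Qed.

Lemma refl_funE a b : real_roots a ->
  refl_fun a b = b - (eps + tau a) *~ (2 * sgn b).
Proof.
move=> ha; rewrite /refl_fun coefE // numq_int.
rewrite (mulrC (2 * sgn b)) [a *~ _]mulrzA; congr (b - _ *~ _).
have [_ Ea] := decompP a; rewrite {1}Ea /tau mulrzDl -mulrzA; congr (_ + _).
by have /rootP [->|->] := ha; rewrite ?mulrNN mulr1 mulr1z.
Qed.

Lemma sgnD a b : sgn (a + b) = sgn a + sgn b.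
Proof.
have [pa Ea] := decompP a; have [pb Eb] := decompP b.
rewrite {1}Ea {1}Eb addrACA -mulrzDr.
exact: (decomp_uniq _ (radicalD pa pb)).1.
Qed.

Lemma sgn_lin n r : radical r -> sgn (eps *~ n + r) = n.
Proof. by move=> r0; exact: (decomp_uniq _ r0).1. Qed.

Lemma p_lin n r : radical r -> p (eps *~ n + r) = r.
Proof. by move=> r0; exact: (decomp_uniq _ r0).2. Qed.

Lemma sgn_rad r : radical r -> sgn r = 0.
Proof. by move/(sgn_lin 0); rewrite mulr0z add0r. Qed.

Lemma sgn_epsD r : radical r -> sgn (eps + r) = 1.
Proof. by move/(sgn_lin 1); rewrite mulr1z. Qed.

Lemma p_epsD r : radical r -> p (eps + r) = r.
Proof. by move/(p_lin 1); rewrite mulr1z. Qed.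

Lemma sgn_eps : sgn eps = 1.
Proof. by have := sgn_epsD radical0; rewrite addr0. Qed.

Lemma root_epsD r : radical r -> real_roots (eps + r).
Proof. by exists r => //; left. Qed.

Lemma tau_epsD r : radical r -> tau (eps + r) = r.
Proof. by move=> r0; rewrite /tau sgn_epsD // p_epsD // mulr1z. Qed.

Lemma sgnN a : sgn (- a) = - sgn a.
Proof.
by apply/eqP; rewrite -addr_eq0 -sgnD addNr sgn_rad //; apply: radical0.
Qed.

Lemma sgnMz a n : sgn (a *~ n) = sgn a * n.
Proof.
have [pa {1}->] := decompP a.
rewrite mulrzDl -mulrzA sgn_lin //; exact: radicalMz.
Qed.

Lemma reflE a b : real_roots a -> refl a b = refl_fun a b.
Proof.
move=> ha; rewrite /refl; case: xgetP => [f _ -> //|no].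
have rD : nmod_morphism (refl_fun a).
  split; first by rewrite refl_funE // sgn_rad ?mulr0 ?mulr0z ?subr0 //; apply: radical0.
  move=> x y; rewrite !refl_funE // sgnD mulrDr mulrzDr opprD; exact: addrACA.
have rK : involutive (refl_fun a).
  move=> x; rewrite !refl_funE // sgnD sgnN sgnMz sgn_epsD; last exact: tau0.
  rewrite mul1r -addrA -opprD -mulrzDr.
  by rewrite (_ : 2 * sgn x + 2 * (sgn x - 2 * sgn x) = 0) ?mulr0z ?subr0 //; ring.
pose gm := GRing.isNmodMorphism.Build A A _ rD.
pose ga : {additive A -> A} := HB.pack (refl_fun a) gm.
have gb : bijective ga by exists ga.
by case: (no (Aut gb)).
Qed.

End Theory.
End A1.

(* Main.v *)
Require Import Defs.
From HB Require Import structures.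
From mathcomp Require Import all_boot all_order all_algebra.
From mathcomp Require Import boolp classical_sets.
From mathcomp Require Import ring.

(** A product [w] of [n] reflections in real roots acts on [A] by
    [b |-> eps *~ ((-1)^n * sgn b) + (p b - T *~ (2 * sgn b))], where [T] is the
    alternating sum attached to the word (lemma [prod_reflE]).  So [w] is known
    once the parity of [n] and [T] are known ([prod_refl_inj]).  Conversely [w]
    determines the parity, which is its effect on the coefficient of [eps], and
    it determines [2 T].  Recovering [T] from [2 T] is impossible when the radical
    has an element of order two, so there the hypothesis [T_indep] has to enter.

    The words [eps + t] and [eps, eps + t] both have alternating sum [t], because
    [eps] contributes zero to it, and they have opposite parities.  Comparing a
    word of [w] with the one of the same parity and with [t = T w] gives the
    normal form of [w]; uniqueness is the converse direction above.

    As the product of two words is their concatenation and the inverse is the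
    reversed word ([WeylP]), the parity is a homomorphism to the signs
    ([signW_mul]).  Its kernel is therefore normal, and the group of order two
    generated by the odd element [refl eps] is a complement to it. *)

(** * Subgroups generated by a set *)

Section GeneratedSubgroups.
Set Implicit Arguments.
Unset Strict Implicit.
Unset Printing Implicit Defensive.
Local Open Scope classical_set_scope.
Variable G : groupType.
Implicit Types (H S : set G) (g h : G).

Lemma is_subgroupP H : is_subgroup H <->
  H 1%g /\ (forall g h, H g -> H h -> H (g * h^-1)%g).
Proof.
split=> [[H1 Hd]|[H1 Hd]]; split; rewrite ?inE //.
- by move: H1; rewrite inE.
- by move=> g h Hg Hh; have := Hd g h; rewrite !inE; apply.
- by move=> g h; rewrite !inE; apply: Hd.
Qed.

Lemma generated_subgroup S : is_subgroup (generated S).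
Proof.
apply/is_subgroupP; split=> [H /is_subgroupP[] //|g h Sg Sh H HH SH].
by have /is_subgroupP[_] := HH; apply; [apply: Sg|apply: Sh].
Qed.

Lemma generated1 S : generated S 1%g.
Proof. by have /is_subgroupP[] := generated_subgroup S. Qed.

Lemma sub_generated S : S `<=` generated S.
Proof. by move=> g Sg H _; apply. Qed.

Lemma is_subgroupM H g h : is_subgroup H -> H g -> H h -> H (g * h)%g.
Proof.
move=> /is_subgroupP[H1 Hd] Hg Hh; rewrite -[h]invgK; apply: (Hd) => //.
by rewrite -[(h^-1)%g]mul1g; apply: Hd.
Qed.

Lemma is_subgroupV H g : is_subgroup H -> H g -> H (g^-1)%g.
Proof. by move=> /is_subgroupP[H1 Hd] Hg; rewrite -[(_^-1)%g]mul1g; apply: Hd. Qed.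

Lemma generated_involution g : (g * g = 1)%g ->
  generated [set g] = [set 1%g; g].
Proof.
move=> gg; have gV : (g^-1 = g)%g by apply/esym/eqP; rewrite -mulg_eq1 gg.
have sub : is_subgroup [set 1%g; g].
  apply/is_subgroupP; split; first by left.
  move=> x y [] -> [] ->; rewrite ?invg1 ?gV ?mulg1 ?mul1g ?gg;
    by [left|right].
rewrite eqEsubset; split=> [x gx|x [->|->]].
- by apply: (gx _ sub) => y ->; right.
- exact: generated1.
- exact: sub_generated.
Qed.

End GeneratedSubgroups.

(** * Words in reflections and the group they form *)

Section A1Weyl.
Set Implicit Arguments.
Unset Strict Implicit.
Unset Printing Implicit Defensive.
Import GRing.Theory.
Local Open Scope classical_set_scope.
Local Open Scope ring_scope.
Variables (A : zmodType) (form : A -> A -> rat) (eps : A).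
Hypotheses (form_sym : sym_form form) (form_add : biadditive form).
Hypotheses (eps2 : form eps eps = 2) (decA : direct_decomp form eps).

Local Notation rad := (radical form).
Local Notation sgn := (sgn form eps).
Local Notation p := (p form eps).
Local Notation tau := (tau form eps).
Local Notation refl := (refl form).
Local Notation prodR := (prod_refl form).
Local Notation Tseq := (T_seq form eps).
Local Notation roots := (root_seq form eps).
Local Notation W := (Weyl form eps).
Local Notation sg := (signW form eps).

Lemma sign_seq_cons a s : sign_seq (a :: s) = - @sign_seq A s.
Proof. by rewrite /sign_seq /= exprS mulN1r. Qed.

Lemma sign_seq_cat s1 s2 : @sign_seq A (s1 ++ s2) = sign_seq s1 * sign_seq s2.
Proof. by rewrite /sign_seq size_cat exprD. Qed.

Lemma T_seq_cons a s : Tseq (a :: s) = tau a *~ sign_seq s + Tseq s.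
Proof.
rewrite /T_seq big_ord_recl /= subn1 /= /tau -mulrzA [sgn a * _]mulrC.
by congr (_ + _); apply: eq_bigr => i _; rewrite /bump /= add1n subSS.
Qed.

Lemma T_seq_nil : Tseq [::] = 0.
Proof. by rewrite /T_seq big_ord0. Qed.

Lemma T_seq_rad s : rad (Tseq s).
Proof.
elim: s => [|a s IH]; first by rewrite T_seq_nil; apply: (radical0 form_add).
rewrite T_seq_cons; apply: (radicalD form_add) => //; apply: (radicalMz form_add) => //.
exact: tau0.
Qed.

Lemma root_seq_cons a s : roots (a :: s) -> real_roots form eps a /\ roots s.
Proof.
move=> h; split=> [|b bs]; first by apply: h; rewrite inE eqxx.
by apply: h; rewrite inE bs orbT.
Qed.

Lemma prod_refl_cons a s : prodR (a :: s) = (refl a * prodR s)%g.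
Proof. by rewrite /prod_refl big_cons. Qed.

Lemma prod_refl_cat s1 s2 : prodR (s1 ++ s2) = (prodR s1 * prodR s2)%g.
Proof. by rewrite /prod_refl big_cat. Qed.

(** A further reflection in front subtracts [eps + tau a], with multiplicity
    twice the current coefficient of [eps]; that coefficient has changed sign
    once per letter already, which is where the alternating signs of the sum
    [T_seq] come from. *)
Lemma prod_reflE s b : roots s ->
  prodR s b = eps *~ (sign_seq s * sgn b) + (p b - Tseq s *~ (2 * sgn b)).
Proof.
elim: s => [|a s IH].
  move=> _; rewrite /prod_refl big_nil aut1 T_seq_nil mul0rz subr0 mul1r.
  by have [] := decompP decA b.
move=> /root_seq_cons[ha hs]; rewrite prod_refl_cons autM.
rewrite (reflE form_sym form_add eps2 decA) //.
rewrite (refl_funE form_sym form_add eps2 decA) // (IH hs).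
have rT : rad (p b - Tseq s *~ (2 * sgn b)).
  apply: (radicalD form_add); first by have [] := decompP decA b.
  by apply: (radicalN form_add) => //; apply: (radicalMz form_add) => //; apply: T_seq_rad.
rewrite (sgn_lin decA) // T_seq_cons sign_seq_cons mulrzDl opprD addrACA.
rewrite -mulrzBr; congr (_ *~ _ + _); first by ring.
rewrite mulrzDl opprD -mulrzA addrA addrAC; congr (_ - _ *~ _); ring.
Qed.

Lemma prod_refl_inj s1 s2 : roots s1 -> roots s2 ->
  sign_seq s1 = sign_seq s2 -> Tseq s1 = Tseq s2 -> prodR s1 = prodR s2.
Proof.
by move=> h1 h2 es eT; apply: aut_ext => b; rewrite !prod_reflE // es eT.
Qed.

(** The parity of a word is read off from the coefficient of [eps] in the image
    of [eps]. *)
Lemma sgn_prod_refl_eps s : roots s -> sgn (prodR s eps) = sign_seq s.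
Proof.
move=> hs; rewrite prod_reflE // (sgn_lin decA).
  by rewrite (sgn_eps form_add decA) mulr1.
apply: (radicalD form_add); first by have [] := decompP decA eps.
by apply: (radicalN form_add) => //; apply: (radicalMz form_add) => //; apply: T_seq_rad.
Qed.

Lemma root_eps : real_roots form eps eps.
Proof. by have := root_epsD eps (radical0 form_add); rewrite addr0. Qed.

Lemma refl_involutive a : real_roots form eps a -> (refl a * refl a = 1)%g.
Proof.
move=> ha; have -> : (refl a * refl a)%g = prodR [:: a; a].
  by rewrite /prod_refl !big_cons big_nil mulg1.
have -> : 1%g = prodR [::] by rewrite /prod_refl big_nil.
apply: prod_refl_inj => //; first by move=> b; rewrite !inE orbb => /eqP->.
by rewrite !T_seq_cons T_seq_nil /sign_seq /= expr0 expr1 addr0 mulrN1z addNr.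
Qed.

Lemma prod_refl_rev s : roots s -> prodR (rev s) = ((prodR s)^-1)%g.
Proof.
elim: s => [|a s IH]; first by rewrite /prod_refl big_nil invg1.
move=> /root_seq_cons[ha hs]; rewrite rev_cons -cats1 prod_refl_cat IH //.
rewrite [prodR (a :: s)]prod_refl_cons invgM [prodR [:: a]]big_seq1; congr (_ * _)%g.
by apply/eqP; rewrite -mulg_eq1 refl_involutive.
Qed.

Lemma root_seq_cat s1 s2 : roots s1 -> roots s2 -> roots (s1 ++ s2).
Proof. by move=> h1 h2 a; rewrite mem_cat => /orP[/h1|/h2]. Qed.

(** Since reflections are involutions, reversing a word inverts its product, so
    products of reflections already form a group. *)
Lemma WeylP w : W w <-> exists2 s, roots s & w = prodR s.
Proof.
split=> [Ww|[s hs ->]].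
  apply: (Ww [set w | exists2 s, roots s & w = prodR s]); last first.
    move=> _ [a ha <-]; exists [:: a]; first by move=> b; rewrite inE => /eqP->.
    by rewrite /prod_refl big_seq1.
  apply/is_subgroupP; split; first by exists [::]; rewrite /prod_refl ?big_nil.
  move=> _ _ [s1 h1 ->] [s2 h2 ->]; exists (s1 ++ rev s2).
    by apply: root_seq_cat => // a; rewrite mem_rev; apply: h2.
  by rewrite prod_refl_cat prod_refl_rev.
elim: s hs => [_|a s IH /root_seq_cons[ha /IH Ws]].
  by rewrite /prod_refl big_nil; apply: generated1.
rewrite prod_refl_cons; apply: (is_subgroupM (generated_subgroup _)) => //.
by apply: sub_generated; exists a.
Qed.

Lemma expressionP w : W w ->
  roots (expression form eps w) /\ w = prodR (expression form eps w).
Proof.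
move=> /WeylP[s hs ws]; rewrite /expression.
by case: xgetP => [x _ //|/(_ s)]; case.
Qed.

(** * The parity homomorphism *)

Lemma signW_prod s : roots s -> sg (prodR s) = sign_seq s.
Proof.
move=> hs; have [|he E] := @expressionP (prodR s); first by apply/WeylP; exists s.
by rewrite /signW -(sgn_prod_refl_eps he) -E sgn_prod_refl_eps.
Qed.

Lemma signW_mul w1 w2 : W w1 -> W w2 -> sg (w1 * w2)%g = sg w1 * sg w2.
Proof.
move=> /WeylP[s1 h1 ->] /WeylP[s2 h2 ->]; rewrite -prod_refl_cat !signW_prod //.
  exact: sign_seq_cat.
exact: root_seq_cat.
Qed.

Lemma signW1 : sg 1%g = 1.
Proof.
have -> : 1%g = prodR [::] by rewrite /prod_refl big_nil.
by rewrite signW_prod.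
Qed.

Lemma signW_eps : sg (refl eps) = -1.
Proof.
have -> : refl eps = prodR [:: eps] by rewrite /prod_refl big_seq1.
by rewrite signW_prod // => a; rewrite inE => /eqP->; apply: root_eps.
Qed.

Lemma signW_sq w : W w -> sg w * sg w = 1.
Proof.
move=> /WeylP[s hs ->]; rewrite signW_prod // /sign_seq -expr2 sqrr_sign //.
Qed.

Lemma signWP w : W w -> sg w = 1 \/ sg w = -1.
Proof.
move=> /WeylP[s hs ->]; rewrite signW_prod // /sign_seq -signr_odd.
by case: odd; [right|left].
Qed.

Lemma signWV w : W w -> sg (w^-1)%g = sg w.
Proof.
move=> Ww; have WV := is_subgroupV (generated_subgroup _) Ww.
rewrite -[LHS]mulr1 -(signW_sq Ww) mulrA -signW_mul // mulVg signW1.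
by rewrite mul1r.
Qed.

(** * Normal forms and the semidirect product *)

(** The optional letter [eps] has [tau eps = 0]: it changes the parity of the
    word and leaves its alternating sum equal to [t]. *)
Definition normal_word (d : bool) (t : A) : seq A := nseq d eps ++ [:: eps + t].

Lemma normal_word_roots d t : rad t -> roots (normal_word d t).
Proof.
move=> t0 a; rewrite /normal_word.
by case: d; rewrite /= !inE; do ?[case/orP]; move=> /eqP->;
  [exact: root_eps| |]; exact: root_epsD.
Qed.

Lemma prod_normal_word d t :
  prodR (normal_word d t) = (refl eps ^+ d * refl (eps + t)%R)%g.
Proof.
rewrite /prod_refl /normal_word big_cat big_seq1; congr (_ * _)%g.
by case: d; rewrite /= ?big_seq1 ?big_nil.
Qed.

Lemma sign_normal_word d t : (sign_seq (normal_word d t) == 1) = d.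
Proof. by case: d. Qed.

Lemma T_normal_word d t : rad t -> Tseq (normal_word d t) = t.
Proof.
have e0 : tau eps = 0.
  by rewrite -{2}[eps]addr0 (tau_epsD decA) //; apply: (radical0 form_add).
by case: d => t0; rewrite /normal_word /= !T_seq_cons T_seq_nil ?e0 ?mul0rz
  ?add0r (tau_epsD decA) // addr0.
Qed.

(** An even [w] needs a normal word of two letters, an odd one a single letter,
    whence the exponent. *)
Lemma Weyl_normal_form w : W w ->
  w = (refl eps ^+ (sg w == 1)%R * refl (eps + T form eps w)%R)%g.
Proof.
move=> Ww; have [he E] := expressionP Ww.
have t0 : rad (T form eps w) by apply: T_seq_rad.
rewrite -prod_normal_word {1}E; apply: prod_refl_inj => //.
- exact: normal_word_roots.
- by rewrite -/(sg w); case: (signWP Ww) => ->.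
- by rewrite T_normal_word.
Qed.

Lemma Weyl_normal_form_uniq w (d : bool) t : W w -> rad t ->
  w = (refl eps ^+ d * refl (eps + t)%R)%g ->
  d = (sg w == 1) /\ (T_indep form eps -> t = T form eps w).
Proof.
move=> Ww t0; rewrite -prod_normal_word => E.
have hn := @normal_word_roots d t t0; split.
  by rewrite E signW_prod // sign_normal_word.
have [he Ee] := expressionP Ww.
by move=> /(_ _ _ hn he); rewrite -E => /(_ Ee); rewrite T_normal_word.
Qed.

Lemma Weyl_sdprod : is_sdprod W (Weyl0 form eps) (Weyl_dot form eps).
Proof.
have sW : is_subgroup W := generated_subgroup _.
have W1 : W 1%g by exact: generated1.
have We : W (refl eps) by apply: sub_generated; exists eps => //; exact: root_eps.
have ee := refl_involutive root_eps.
have dotE : Weyl_dot form eps = [set 1%g; refl eps] := generated_involution ee.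
have dotW : Weyl_dot form eps `<=` W by rewrite dotE => _ [] ->.
split; split => //.
- apply/is_subgroupP; split; first by split=> //; exact: signW1.
  move=> g h [Wg g1] [Wh h1]; have WV := is_subgroupV sW Wh.
  split; first exact: (is_subgroupM sW).
  by rewrite signW_mul // signWV // g1 h1.
- exact: generated_subgroup.
- split=> [g [] //|g n Wg [Wn n1]]; have WV := is_subgroupV sW Wg.
  have Wng : W (n * g)%g by exact: (is_subgroupM sW).
  rewrite /conjg; split; first exact: (is_subgroupM sW).
  by rewrite !signW_mul // n1 mul1r signWV // signW_sq.
- rewrite dotE eqEsubset; split=> [w [[-> //|->] [_]]|_ ->].
    by rewrite signW_eps.
  by split; [left|split=> //; exact: signW1].
- rewrite eqEsubset; split=> [w Ww|_ [h /dotW Wh] [n [Wn _]] <-]; last first.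
    exact: (is_subgroupM sW).
  rewrite dotE; case: (signWP Ww) => w1.
    by exists 1%g; [left|exists w => //; rewrite mul1g].
  (* An odd element becomes even after multiplication by the involution
     [refl eps]. *)
  exists (refl eps); first by right.
  exists (refl eps * w)%g; last by rewrite mulgA ee mul1g.
  split; first exact: (is_subgroupM sW).
  by rewrite signW_mul // signW_eps w1.
Qed.

End A1Weyl.

Theorem theorem1p11 (A : zmodType) (form : A -> A -> rat) (eps : A)
    (form_sym : sym_form form) (form_add : biadditive form)
    (form_psd : pos_semidef form) (eps2 : form eps eps = 2%:R%R)
    (decA : direct_decomp form eps) :
  (forall w : aut A, Weyl form eps w ->
     [/\ radical form (T form eps w),
         w = (refl form eps ^+ (signW form eps w == 1%R)
              * refl form (eps + T form eps w)%R)%g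
       & forall (d : bool) (t : A), radical form t ->
           w = (refl form eps ^+ d * refl form (eps + t)%R)%g ->
           d = (signW form eps w == 1%R) /\
           (T_indep form eps -> t = T form eps w)])
  /\ is_sdprod (Weyl form eps) (Weyl0 form eps) (Weyl_dot form eps).
Proof.
split; last exact: Weyl_sdprod.
move=> w Ww; split.
- exact: T_seq_rad.
- exact: Weyl_normal_form.
- by move=> d t t0 E; apply: Weyl_normal_form_uniq.
Qed.
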